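(* Let $R$ be a Dedekind domain, $I$ an ideal of $R$, $M$ a finitely generated $R$-module and $F$ a finitely generated functor. Then the sequence of sets $\{\operatorname{Ass}_R F(M/I^nM)\}_{n\ge 1}$ is eventually constant.
   Context: For an $R$-module $X$, $h_X=\operatorname{Hom}_R(X,-)$. A functor means an $R$-linear covariant functor from the category of finitely generated $R$-modules to itself. $F$ is finitely generated if there is a finitely generated $R$-module $L$ and a surjective natural transformation $h_L\to F$ (an exact sequence $h_L\to F\to 0$ of functors). *)

(* Defs.v *)
From mathcomp Require Import all_boot all_order all_algebra.
Set Implicit Arguments. Unset Strict Implicit. Unset Printing Implicit Defensive.
Import Order.TTheory GRing.Theory Num.Theory.
Local Open Scope ring_scope.

Section Ideals.
Variable R : comNzRingType.

Definition is_ideal (I : R -> Prop) : Prop :=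
  [/\ I 0, (forall x y, I x -> I y -> I (x + y)) & (forall r x, I x -> I (r * x))].

Definition is_prime_ideal (P : R -> Prop) : Prop :=
  [/\ is_ideal P, ~ P 1 & (forall a b, P (a * b) -> P a \/ P b)].

Definition is_maximal_ideal (P : R -> Prop) : Prop :=
  [/\ is_ideal P, ~ P 1 &
      (forall J : R -> Prop, is_ideal J -> (forall x, P x -> J x) ->
         (forall x, J x) \/ (forall x, J x <-> P x))].

Definition ideal_fg (I : R -> Prop) : Prop :=
  exists s : seq R, forall x,
    I x <-> exists t : seq R, size t = size s /\ x = \sum_(i < size s) t`_i * s`_i.

Definition noetherian_ring : Prop :=
  forall I : R -> Prop, is_ideal I -> ideal_fg I.

Definition ideal_mul (I J : R -> Prop) : R -> Prop :=
  fun x => exists s : seq (R * R),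
    (forall p, p \in s -> I p.1 /\ J p.2) /\ x = \sum_(p <- s) p.1 * p.2.

Fixpoint ideal_pow (I : R -> Prop) (n : nat) : R -> Prop :=
  match n with
  | 0 => fun _ => True
  | n'.+1 => ideal_mul I (ideal_pow I n')
  end.
End Ideals.

Definition integrally_closed (R : idomainType) : Prop :=
  forall x : {fraction R},
    (exists p : {poly R}, p \is monic /\ (map_poly (@tofrac R) p).[x] = 0) ->
    exists r : R, x = @tofrac R r.

Definition dedekind_domain (R : idomainType) : Prop :=
  [/\ noetherian_ring R, integrally_closed R &
      forall P : R -> Prop, is_prime_ideal P -> (exists x, P x /\ x != 0) ->
        is_maximal_ideal P].

Section Modules.
Variable R : comNzRingType.

Definition module_fg (M : lmodType R) : Prop :=
  exists s : seq M, forall x : M,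
    exists t : seq R, size t = size s /\ x = \sum_(i < size s) t`_i *: s`_i.

Definition ideal_smul (J : R -> Prop) (M : lmodType R) : M -> Prop :=
  fun x => exists s : seq (R * M),
    (forall p, p \in s -> J p.1) /\ x = \sum_(p <- s) p.1 *: p.2.


Definition is_assoc_prime (N : lmodType R) (P : R -> Prop) : Prop :=
  is_prime_ideal P /\ exists x : N, forall r, P r <-> r *: x = 0.

Definition is_quotient (M Q : lmodType R) (K : M -> Prop) (pi : M -> Q) : Prop :=
  [/\ linear pi, (forall q, exists m, pi m = q) & (forall m, pi m = 0 <-> K m)].

Record fg_functor := FgFunctor {
  fobj : lmodType R -> lmodType R;
  fmap : forall M N : lmodType R, (M -> N) -> fobj M -> fobj N;
}.
Arguments fmap f {M N} _ _.
Arguments fobj f M.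

Definition is_linear_functor (F : fg_functor) : Prop :=
  [/\ (forall M : lmodType R, module_fg M -> module_fg (fobj F M)),
      (forall (M N : lmodType R) (f : M -> N), module_fg M -> module_fg N -> linear f ->
         linear (fmap F f)),
      (forall (M N : lmodType R) (f g : M -> N), module_fg M -> module_fg N ->
         linear f -> linear g -> (forall x, f x = g x) ->
         forall y, fmap F f y = fmap F g y) /\
      (forall M : lmodType R, module_fg M -> forall y, fmap F (fun x : M => x) y = y),
      (forall (M N P : lmodType R) (f : M -> N) (g : N -> P),
         module_fg M -> module_fg N -> module_fg P -> linear f -> linear g ->
         forall y, fmap F (fun x => g (f x)) y = fmap F g (fmap F f y)) &
      (forall (M N : lmodType R) (f g : M -> N) (r : R), module_fg M -> module_fg N ->
         linear f -> linear g ->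
         forall y, fmap F (fun x => r *: f x + g x) y
                   = r *: fmap F f y + fmap F g y)].

(** F is finitely generated : there are a f.g. module L and a surjective
    natural transformation eta : Hom_R(L, -) -> F (with R-linear components). *)
Definition functor_fg (F : fg_functor) : Prop :=
  exists (L : lmodType R)
         (eta : forall X : lmodType R, (L -> X) -> fobj F X),
  [/\ module_fg L,
      (forall (X : lmodType R) (f g : L -> X) (r : R), module_fg X -> linear f -> linear g ->
         eta X (fun x => r *: f x + g x) = r *: eta X f + eta X g),
      (forall (X Y : lmodType R) (f : L -> X) (h : X -> Y), module_fg X -> module_fg Y ->
         linear f -> linear h ->
         eta Y (fun x => h (f x)) = fmap F h (eta X f)),
      (* well defined on Hom(L,X) up to extensional equality *)
      (forall (X : lmodType R) (f g : L -> X), module_fg X -> linear f -> linear g ->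
         (forall x, f x = g x) -> eta X f = eta X g) &
      (forall X : lmodType R, module_fg X -> forall y : fobj F X,
         exists f : L -> X, linear f /\ eta X f = y)].
End Modules.
Arguments ideal_smul {R} J M _.

(* Main.v *)
Require Import Defs.
From mathcomp Require Import all_boot all_order all_algebra.
From mathcomp Require Import boolp ring.
Set Implicit Arguments. Unset Strict Implicit. Unset Printing Implicit Defensive.
Import GRing.Theory.
Local Open Scope ring_scope.

(** If [I = 0] all the [Q n] are isomorphic. Otherwise every associated prime of
    [F (Q n)] contains [I], there are finitely many such primes, and it suffices to
    treat each of them, [P], separately. Then [P] is associated to [F (Q n)] iff
    [F (Q n)] does not vanish at [P], and one shows that for [c <= k <= n <= m]
    vanishing at [k] and at [m] implies vanishing at [n].

    Near [P] the ideal [I] is generated by one element [a], and both [M] and the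
    module [L] covering [F] are a free module plus a summand killed by a power of [a].
    A map [L -> Q n] splits accordingly. Its free part lifts along [Q m -> Q n]. Its
    torsion part lands in the elements killed by [a ^ c], and these come from [Q k],
    either by multiplication by [a ^ (n - k)] (on the free part of [M]) or by the
    identity (on the torsion part of [M]). So the elements of [F (Q n)] come from
    [F (Q m)] and [F (Q k)].

    Localisation at [P] is replaced by multiplication by elements outside [P]. *)

(** * Linear maps, and their construction from linear relations *)

Lemma linear_selection (R : comNzRingType) (A B : lmodType R) (G : A -> B -> Prop) :
  (forall x, exists y, G x y) ->
  (forall r x y x' y', G x y -> G x' y' -> G (r *: x + x') (r *: y + y')) ->
  (forall y, G 0 y -> y = 0) ->
  exists f : A -> B, linear f /\ forall x, G x (f x).
Proof.
move=> Gtot Gadd G0; have [f Gf] := choice Gtot.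
exists f; split => // r x y.
(* [G] relates [0] to the difference of [f (r *: x + y)] and [r *: f x + f y], so this difference is
   zero. *)
have := Gadd (-1) _ _ _ _ (Gadd r _ _ _ _ (Gf x) (Gf y)) (Gf (r *: x + y)).
by rewrite !scaleN1r addNr => /G0 /(canRL (addNKr _)); rewrite addr0.
Qed.

Section LinearMaps.
Variables (R : comNzRingType) (A B C : lmodType R).

Lemma lin0 (f : A -> B) : linear f -> f 0 = 0.
Proof. by move=> fl; have := fl (-1) 0 0; rewrite !scaleN1r oppr0 addr0 addNr. Qed.

Lemma linD (f : A -> B) x y : linear f -> f (x + y) = f x + f y.
Proof. by move=> fl; have := fl 1 x y; rewrite !scale1r. Qed.

Lemma linZ (f : A -> B) r x : linear f -> f (r *: x) = r *: f x.
Proof. by move=> fl; have := fl r x 0; rewrite !addr0 (lin0 fl) addr0. Qed.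

Lemma linB (f : A -> B) x y : linear f -> f (x - y) = f x - f y.
Proof. by move=> fl; rewrite linD // -!scaleN1r linZ. Qed.

Lemma lin_sum (f : A -> B) (T : Type) (s : seq T) (F : T -> A) :
  linear f -> f (\sum_(i <- s) F i) = \sum_(i <- s) f (F i).
Proof.
move=> fl; elim: s => [|i s IH]; first by rewrite !big_nil lin0.
by rewrite !big_cons linD // IH.
Qed.

Lemma linear_comp (f : A -> B) (g : B -> C) :
  linear f -> linear g -> linear (fun x => g (f x)).
Proof. by move=> fl gl r x y; rewrite fl gl. Qed.

Lemma linear_scale (r : R) (f : A -> B) : linear f -> linear (fun x => r *: f x).
Proof. by move=> fl a x y; rewrite fl scalerDr !scalerA mulrC. Qed.

Lemma linear_bigsum (T : Type) (s : seq T) (f : T -> A -> B) :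
  (forall i, linear (f i)) -> linear (fun x => \sum_(i <- s) f i x).
Proof.
move=> fl a x y; elim: s => [|i s IH]; first by rewrite !big_nil scaler0 addr0.
by rewrite !big_cons IH fl scalerDr addrACA.
Qed.

Lemma linear_scale_vec (f : A -> R^o) (b : B) : linear f -> linear (fun x => f x *: b).
Proof. by move=> fl a x y; rewrite fl scalerDl scalerA. Qed.

End LinearMaps.

Lemma linear_defect (R : comNzRingType) (L : lmodType R) (s : R) n
    (alpha : 'I_n -> L -> R^o) (l : 'I_n -> L) :
  (forall i, linear (alpha i)) -> linear (fun x => s *: x - \sum_i alpha i x *: l i).
Proof.
move=> al r x y; rewrite scalerDr !scalerA [s * r]mulrC scalerBr addrACA -opprD scalerA.
congr (_ - _); rewrite scaler_sumr -big_split; apply: eq_bigr => i _.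
by rewrite al scalerDl scalerA.
Qed.

(** * Ideals, Noetherian induction and products of primes *)

Section Ideals.
Variable R : comNzRingType.
Implicit Types (I J P : R -> Prop).

Lemma idealZ I r x : is_ideal I -> I x -> I (r * x).
Proof. by case=> _ _; apply. Qed.

Lemma idealD I x y : is_ideal I -> I x -> I y -> I (x + y).
Proof. by case=> _ + _; apply. Qed.

Lemma ideal0 I : is_ideal I -> I 0.
Proof. by case. Qed.

Lemma ideal_sum I (T : Type) (s : seq T) (F : T -> R) :
  is_ideal I -> (forall i, I (F i)) -> I (\sum_(i <- s) F i).
Proof.
move=> Ii IF; elim: s => [|i s IH]; first by rewrite big_nil; apply: ideal0.
by rewrite big_cons; apply: idealD.
Qed.

Lemma ideal_fg_gens I : ideal_fg I ->
  exists n (g : 'I_n -> R), (forall i, I (g i)) /\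
    forall x, I x -> exists t : 'I_n -> R, x = \sum_i t i * g i.
Proof.
case=> s Hs; exists (size s), (fun i => s`_i); split=> [i|x /Hs[t [_ ->]]].
  apply/Hs; exists (mkseq (fun j => (j == i)%:R) (size s)); rewrite size_mkseq.
  split=> //; rewrite (bigD1 i) //= nth_mkseq // eqxx mul1r big1 ?addr0 // => j ji.
  by rewrite nth_mkseq // val_eqE (negPf ji) mul0r.
by exists (fun i => t`_i).
Qed.

Lemma module_fg_gens (M : lmodType R) : module_fg M ->
  exists n (g : 'I_n -> M), forall x, exists t : 'I_n -> R, x = \sum_i t i *: g i.
Proof.
case=> s Hs; exists (size s), (fun i => s`_i) => x.
by have [t [_ ->]] := Hs x; exists (fun i => t`_i).
Qed.

Lemma module_fg_image (M N : lmodType R) (f : M -> N) :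
  linear f -> (forall y, exists x, f x = y) -> module_fg M -> module_fg N.
Proof.
move=> fl fs [s Hs]; exists (map f s) => y; have [x <-] := fs y.
have [t [st ->]] := Hs x; exists t; rewrite size_map; split=> //.
rewrite lin_sum //; apply: eq_bigr => i _; rewrite linZ //.
by rewrite (nth_map 0).
Qed.

(** A counterexample would start a strictly ascending chain of counterexamples. The union of the
    chain is finitely generated, so it is already reached at a finite stage. *)
Lemma noetherian_ind (Phi : (R -> Prop) -> Prop) : noetherian_ring R ->
  (forall J, is_ideal J ->
     (forall J', is_ideal J' -> (forall x, J x -> J' x) -> (exists x, J' x /\ ~ J x) ->
        Phi J') -> Phi J) ->
  forall J, is_ideal J -> Phi J.
Proof.
move=> noeth step J0 J0i; apply: contrapT => nPhi.
pose bad J := is_ideal J /\ ~ Phi J.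
have /choice[next nextP] : forall J, exists J', bad J ->
    [/\ bad J', (forall x, J x -> J' x) & exists x, J' x /\ ~ J x].
  move=> J; case: (EM (bad J)) => [[Ji nJ]|nb]; last by exists J.
  apply: contrapT => /forallNP H; apply: nJ; apply: step => // J' J'i JJ' Jx.
  by apply: contrapT => nJ'; apply: (H J') => _; split.
pose c n := iter n next J0.
have cbad n : bad (c n) by elim: n => //= n /nextP[].
have cS n x : c n x -> c n.+1 x by case: (nextP _ (cbad n)) => _ + _; apply.
have cmono m n x : (m <= n)%N -> c m x -> c n x.
  move=> /subnK <-; elim: (n - m)%N => // k IH cm; rewrite addSn.
  exact/cS/IH.
have Ui : is_ideal (fun x => exists n, c n x).
  split; first by exists 0%N; case: (cbad 0%N) => /ideal0.
    move=> x y [m cx] [n cy]; exists (maxn m n); have [ci _] := cbad (maxn m n).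
    by apply: idealD ci _ _; [apply: cmono cx; rewrite leq_maxl|apply: cmono cy; rewrite leq_maxr].
  by move=> r x [n cx]; exists n; have [ci _] := cbad n; apply: idealZ.
have [k [g [/choice[N Ng] gen]]] := ideal_fg_gens (noeth _ Ui).
pose n := \max_i N i.
have [_ _ [x [xS]]] := nextP _ (cbad n); apply.
have [t ->] := gen x (ex_intro _ n.+1 xS).
have [ci _] := cbad n; apply: ideal_sum => // i; apply: idealZ => //.
by apply: cmono (Ng i); apply: (leq_bigmax i).
Qed.

Lemma is_ideal_add_principal J a : is_ideal J ->
  is_ideal (fun x => exists y r, J y /\ x = y + r * a).
Proof.
move=> Ji; split.
- by exists 0, 0; rewrite mul0r addr0; split=> //; apply: ideal0.
- move=> x y [x' [r [Jx ->]]] [y' [r' [Jy ->]]]; exists (x' + y'), (r + r').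
  by split; [apply: idealD|ring].
- move=> s x [x' [r [Jx ->]]]; exists (s * x'), (s * r).
  by split; [apply: idealZ|ring].
Qed.

(** For an ideal [J], this is containment of the product of the ideals in [l]. The elementwise form
    makes sense for any subset [J], which inductions on [l] exploit. *)
Definition prod_sub (l : seq (R -> Prop)) J :=
  forall t, List.Forall2 (fun P x => P x) l t -> J (\prod_(x <- t) x).

Lemma maximal_eq P J : is_maximal_ideal P -> is_ideal J ->
  (forall x, P x -> J x) -> ~ J 1 -> J = P.
Proof.
by move=> [_ _ Pm] Ji PJ J1; case: (Pm _ Ji PJ) => [/(_ 1)//|/predeqP].
Qed.

Lemma prod_cons x (t : seq R) : \prod_(y <- x :: t) y = x * \prod_(y <- t) y.
Proof. exact: big_cons. Qed.

Lemma prime_expr P n x : is_prime_ideal P -> P (x ^+ n) -> P x.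
Proof.
move=> [_ P1 Pp]; elim: n => [|n IH]; first by rewrite expr0.
by rewrite exprS => /Pp[//|/IH].
Qed.

End Ideals.

(** Noetherian induction: if [a * b] is in [J] but [a] and [b] are not, then [J + (a)] and [J + (b)]
    contain products of nonzero primes, and the product of these two ideals lies in [J]. The unit
    ideal takes the empty product. *)
Lemma primes_product_sub (R : idomainType) (J : R -> Prop) :
  noetherian_ring R -> is_ideal J -> (exists x, J x /\ x != 0) ->
  exists l : seq (R -> Prop),
    List.Forall (fun P => is_prime_ideal P /\ exists x, P x /\ x != 0) l /\
    prod_sub l J.
Proof.
move=> noeth; move: J; apply: noetherian_ind => // J Ji IH [z [Jz z0]].
case: (EM (is_prime_ideal J)) => [Jp|nJp].
  exists [:: J]; split; first by constructor=> //; split=> //; exists z.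
  move=> t H; inversion_clear H as [|? x ? t' Jx Ht]; inversion_clear Ht.
  by rewrite big_seq1.
case: (EM (J 1)) => [J1|nJ1].
  exists [::]; split=> // t H; inversion_clear H; by rewrite big_nil.
have [a [b [Jab [nJa nJb]]]] : exists a b, J (a * b) /\ ~ J a /\ ~ J b.
  apply: contrapT => H; apply: nJp; split=> // a b Jab; apply: contrapT.
  by move=> /not_orP[na nb]; apply: H; exists a, b.
have aux c : ~ J c -> exists l : seq (R -> Prop),
    List.Forall (fun P => is_prime_ideal P /\ exists x, P x /\ x != 0) l /\
    prod_sub l (fun x => exists y r, J y /\ x = y + r * c).
  move=> nJc.
  have incl x : J x -> exists y r, J y /\ x = y + r * c.
    by move=> Jx; exists x, 0; rewrite mul0r addr0.
  apply: IH => //; first exact: is_ideal_add_principal.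
    by exists c; split=> //; exists 0, 1; rewrite mul1r add0r; split=> //; exact: ideal0.
  by exists z; split=> //; apply: incl.
have [la [Hla pa]] := aux _ nJa; have [lb [Hlb pb]] := aux _ nJb.
exists (la ++ lb); split; first by apply/List.Forall_app.
move=> t /List.Forall2_app_inv_l[ta [tb [/pa[y [r [Jy ea]]] [/pb[y' [r' [Jy' eb]]] ->]]]].
rewrite big_cat /= ea eb.
have -> : (y + r * a) * (y' + r' * b) = (y' + r' * b) * y + r * a * y' + r * r' * (a * b) by ring.
by apply: idealD => //; [apply: idealD => //|]; apply: idealZ.
Qed.

(** * A Dedekind domain localised at a nonzero prime, with denominators cleared *)

Section LocalizationAtPrime.
Variables (R : idomainType) (P : R -> Prop).
Hypotheses (dedR : dedekind_domain R) (primeP : is_prime_ideal P)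
  (P_neq0 : exists x, P x /\ x != 0).
Implicit Types (J : R -> Prop) (a b s u x : R).

Let noeth : noetherian_ring R. Proof. by case: dedR. Qed.
Let idealP : is_ideal P. Proof. by case: primeP. Qed.
Let maxP : is_maximal_ideal P. Proof. by case: dedR => _ _; apply. Qed.
Let nP1 : ~ P 1. Proof. by case: primeP. Qed.
Let nPM s u : ~ P s -> ~ P u -> ~ P (s * u).
Proof. by case: primeP => _ _ H ns nu /H[]. Qed.
Let nPX s n : ~ P s -> ~ P (s ^+ n).
Proof. by move=> ns /(prime_expr primeP). Qed.

(** Take a product of nonzero primes inside [J]. The factors contained in [P] equal [P] by
    maximality and form the power [P ^ j]; each other factor contributes to [s] an element outside
    [P]. *)
Lemma prime_power_sub J : is_ideal J -> (exists x, J x /\ x != 0) ->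
  exists j s, ~ P s /\
    forall t : seq R, size t = j -> (forall x, x \in t -> P x) -> J (s * \prod_(x <- t) x).
Proof.
move=> Ji Jn0; have [l [Hl]] := primes_product_sub noeth Ji Jn0.
(* The induction replaces [J] by colons, of which only closure under multiples has to be known. *)
have {Ji Jn0} : forall r x, J x -> J (r * x) by move=> r x; apply: idealZ.
elim: l Hl J => [|Q l IH] Hl J JM pl.
  exists 0%N, 1; split=> // t /size0nil-> _; rewrite big_nil mulr1.
  by have := pl [::] (List.Forall2_nil _); rewrite big_nil.
move/List.Forall_cons_iff: Hl => [[Qp Qn0] /IH{}IH].
have [QP|nQP] := EM (forall x, Q x -> P x).
  have maxQ : is_maximal_ideal Q by case: dedR => _ _; apply.
  have ePQ : P = Q by apply: maximal_eq.
  have [||j [s [nPs Hs]]] := IH (fun x => forall p, P p -> J (p * x)).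
  - by move=> r x H p Pp; rewrite mulrCA; apply/JM/H.
  - move=> t Ht p Pp; rewrite -prod_cons; apply: pl.
    by constructor=> //; rewrite -ePQ.
  exists j.+1, s; split=> // -[|p t] //= [st] tP; rewrite prod_cons mulrCA.
  apply: Hs => // [x xt|]; apply: tP; by rewrite inE ?xt ?eqxx ?orbT.
have [s1 /not_implyP[Qs1 nPs1]] : exists x, ~ (Q x -> P x) by apply/existsNP.
have [||j [s [nPs Hs]]] := IH (fun x => J (s1 * x)).
- by move=> r x H; rewrite mulrCA; apply/JM/H.
- by move=> t Ht; rewrite -prod_cons; apply: pl; constructor.
exists j, (s1 * s); split; first exact: nPM.
by move=> t st tP; rewrite -mulrA; apply: Hs.
Qed.

(** Multiply [z] by elements of [P] as long as the result stays outside [K]; this stops in fewer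
    than [j] steps. The annihilator modulo [K] is then a proper ideal containing the maximal ideal
    [P]. *)
Lemma prime_annihilator_multiple (N : lmodType R) (K : N -> Prop) (z : N) j :
  K 0 -> (forall m m', K m -> K m' -> K (m + m')) -> (forall r m, K m -> K (r *: m)) ->
  ~ K z ->
  (forall t : seq R, size t = j -> (forall x, x \in t -> P x) -> K (\prod_(x <- t) x *: z)) ->
  exists t, forall r, P r <-> K (r *: (t *: z)).
Proof.
move=> K0 KD KZ; elim: j z => [|j IH] z nKz Hz.
  by have := Hz [::] erefl; rewrite big_nil scale1r => H; case: nKz; apply: H.
have [zP|nzP] := EM (forall p, P p -> K (p *: z)).
  have annz : is_ideal (fun r => K (r *: z)).
    split=> [|x y Kx Ky|r x Kx]; first by rewrite scale0r.
      by rewrite scalerDl; apply: KD.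
    by rewrite -scalerA; apply: KZ.
  exists 1 => r; rewrite scale1r.
  suff e : (fun r => K (r *: z)) = P by rewrite -[in P r]e.
  by apply: maximal_eq => //; rewrite scale1r.
have [p /not_implyP[Pp nKp]] : exists p, ~ (P p -> K (p *: z)) by apply/existsNP.
have [|t Ht] := IH (p *: z) nKp.
  move=> t st tP; rewrite scalerA mulrC -prod_cons; apply: Hz => /=; first by rewrite st.
  by move=> x; rewrite inE => /orP[/eqP->|/tP].
by exists (t * p) => r; rewrite Ht !scalerA mulrA.
Qed.

(* The determinant trick: [b / a] is integral because it stabilises [P]. *)
Lemma prime_stable_fraction a b : a != 0 ->
  (forall p, P p -> exists v, P v /\ b * p = a * v) -> exists r, b = a * r.
Proof.
move=> a0 stab; have [n [g [Pg gen]]] := ideal_fg_gens (noeth idealP).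
have /choice[A HA] : forall i, exists t : 'I_n -> R, b * g i = a * \sum_j t j * g j.
  move=> i; have [v [Pv ->]] := stab _ (Pg i).
  by have [t ->] := gen _ Pv; exists t.
pose B : 'M[R]_n := \matrix_(j, i) A i j.
pose x := tofrac b / tofrac a.
have a0' : tofrac a != 0 by rewrite tofrac_eq0.
suff : root (char_poly (map_mx (@tofrac R) B)) x.
  rewrite -map_char_poly => /rootP rt.
  case: dedR => _ /(_ x) + _; case.
    by exists (char_poly B); split; first exact: char_poly_monic.
  move=> r /(congr1 (fun y => y * tofrac a)); rewrite divfK // -tofracM => /eqP.
  by rewrite tofrac_eq => /eqP->; exists r; rewrite mulrC.
rewrite -eigenvalue_root_char; apply/eigenvalueP.
(* The row of generators of [P] is a left eigenvector of [B] for [b / a], nonzero because [P] is;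
   the characteristic polynomial of [B] is the integral equation. *)
exists (\row_j tofrac (g j)); last first.
  apply/eqP => /rowP g0; have [y [Py /eqP]] := P_neq0; apply.
  have [t ->] := gen _ Py; apply: big1 => i _.
  by have /eqP := g0 i; rewrite !mxE tofrac_eq0 => /eqP->; rewrite mulr0.
apply/rowP => i; rewrite !mxE; apply: (mulfI a0').
rewrite /x mulrA mulrCA divff // mulr1 -tofracM HA tofracM; congr (_ * _).
rewrite rmorph_sum /=; apply: eq_bigr => j _.
by rewrite !mxE tofracM mulrC.
Qed.

Lemma prod_nseq j x : \prod_(y <- nseq j x) y = x ^+ j.
Proof. by elim: j => [|j IH]; [rewrite big_nil|rewrite prod_cons IH exprS]. Qed.

Lemma is_ideal_principal a : is_ideal (fun x => exists y, x = a * y).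
Proof.
split=> [|x y [x' ->] [y' ->]|r x [x' ->]].
- by exists 0; rewrite mulr0.
- by exists (x' + y'); rewrite mulrDr.
- by exists (r * x'); rewrite mulrCA.
Qed.

Lemma principal_prime_power_sub a : a != 0 ->
  exists j s, ~ P s /\
    forall t : seq R, size t = j -> (forall x, x \in t -> P x) ->
      exists y, s * \prod_(x <- t) x = a * y.
Proof.
move=> a0; apply: (prime_power_sub (is_ideal_principal a)).
by exists a; split=> //; exists 1; rewrite mulr1.
Qed.

Lemma local_expr_dvd a b : a != 0 -> P b ->
  exists j s y, ~ P s /\ s * b ^+ j = a * y.
Proof.
move=> a0 Pb; have [j [s [nPs Hs]]] := principal_prime_power_sub a0.
have [|x|y Hy] := Hs (nseq j b); first by rewrite size_nseq.
  by rewrite mem_nseq => /andP[_ /eqP->].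
by exists j, s, y; rewrite -prod_nseq.
Qed.

(** Some fraction [b / a] carries [P] into [R] but not into [P]: [b * p = a * u] with [u] outside
    [P]. For [x] in [P], dividing [b * x] by [a] then shows that [p] divides [u * x]. *)
Lemma local_uniformizer :
  exists p u, [/\ P p, ~ P u & forall x, P x -> exists v, u * x = p * v].
Proof.
have [a [Pa a0]] := P_neq0.
have [j [s [nPs Hs]]] := principal_prime_power_sub a0.
have [I0 ID IZ] := is_ideal_principal a.
have [|t|t Ht] := @prime_annihilator_multiple R^o _ s j I0 ID IZ.
- by move=> [y ey]; apply: nPs; rewrite ey mulrC; apply: idealZ.
- by move=> st tP; have [y Hy] := Hs t st tP; exists y; rewrite -Hy /GRing.scale /= mulrC.
pose b := t * s.
have {}Ht r : P r <-> exists y, r * b = a * y by exact: Ht.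
(* Otherwise [b / a] stabilises [P], hence lies in [R], and [1] would be in the annihilator [P] of
   [b] modulo [a]. *)
have [p [u [Pp nPu ebp]]] : exists p u, [/\ P p, ~ P u & b * p = a * u].
  apply: contrapT => H; have [//|p Pp|r er] := @prime_stable_fraction a b.
    have /Ht[v ev] := Pp; exists v; rewrite mulrC; split=> //.
    by apply: contrapT => nPv; apply: H; exists p, v; rewrite mulrC.
  by apply: nP1; apply/Ht; exists r; rewrite mul1r.
exists p, u; split=> // x Px; have /Ht[v ev] := Px; exists v.
apply: (mulfI a0); rewrite mulrA -ebp mulrAC [b * x]mulrC ev; ring.
Qed.

(** If every cofactor stayed in [P], all powers of [p] would divide [a] up to powers of [u]. But [a]
    divides some [s * p ^ j], so [s * u ^ j.+1] would be a multiple of [p]. *)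
Lemma local_valuation : exists p, P p /\ forall a, a != 0 ->
  exists k s c, [/\ ~ P s, ~ P c & s * a = p ^+ k * c].
Proof.
have [p [u [Pp nPu unif]]] := local_uniformizer.
exists p; split=> // a a0; apply: contrapT => H.
have [j [s [y [nPs ey]]]] := local_expr_dvd a0 Pp.
have step k : exists c, u ^+ k * a = p ^+ k * c.
  elim: k => [|k [c ec]]; first by exists a; rewrite !expr0.
  have Pc : P c by apply: contrapT => nPc; apply: H; exists k, (u ^+ k), c; split=> //; apply: nPX.
  have [v ev] := unif _ Pc; exists v.
  by rewrite exprS -mulrA ec mulrCA ev exprSr mulrA.
have [c ec] := step j.+1.
have : s * u ^+ j.+1 = y * c * p.
  apply: (mulIf a0); rewrite -mulrA ec exprS.
  have -> : y * c * p * a = (a * y) * (c * p) by ring.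
  by rewrite -ey; ring.
by move=> e; apply: (nPM nPs (nPX (n := j.+1) nPu)); rewrite e; apply: idealZ.
Qed.

Definition local_dvd a b := exists s y, ~ P s /\ s * b = a * y.

(** The localisation is a valuation ring: the exponents of [p] are compared. *)
Lemma local_dvd_total a b : local_dvd a b \/ local_dvd b a.
Proof.
have [->|a0] := eqVneq a 0; first by right; exists 1, 0; rewrite !mulr0.
have [->|b0] := eqVneq b 0; first by left; exists 1, 0; rewrite !mulr0.
have [p [_ val]] := local_valuation.
wlog suff main : / forall a b i j s s' c c', (i <= j)%N -> ~ P s' -> ~ P c ->
    s * a = p ^+ i * c -> s' * b = p ^+ j * c' -> local_dvd a b.
  have [i [s [c [ns nc ea]]]] := val _ a0; have [j [s' [c' [ns' nc' eb]]]] := val _ b0.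
  have [ij|/ltnW ji] := leqP i j.
    by left; apply: main ij ns' nc ea eb.
  by right; apply: main ji ns nc' eb ea.
move=> {a0 b0}a {}b i j s s' c c' ij ns' nc ea eb.
exists (s' * c), (p ^+ (j - i) * c' * s); split; first exact: nPM.
rewrite mulrAC eb -(subnKC ij) exprD addKn.
have -> : a * (p ^+ (j - i) * c' * s) = (s * a) * (p ^+ (j - i) * c') by ring.
by rewrite ea; ring.
Qed.

Lemma local_dvd_min (T : finType) (g : T -> R) i0 : g i0 != 0 ->
  exists j s, [/\ ~ P s, g j != 0 & forall i, exists y, s * g i = g j * y].
Proof.
move=> g0.
suff [j [s [ns gj H]]] : exists j s, [/\ ~ P s, g j != 0 &
    forall i, i \in enum T -> exists y, s * g i = g j * y].
  by exists j, s; split=> // i; apply: H; rewrite mem_enum.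
elim: (enum T) => [|i l [j [s [ns gj H]]]]; first by exists i0, 1.
have [[s' [y [ns' e]]]|[s' [y [ns' e]]]] := local_dvd_total (g j) (g i).
  exists j, (s' * s); split=> //; first exact: nPM.
  move=> k; rewrite inE => /orP[/eqP->|/H[z ez]].
    by exists (s * y); rewrite mulrAC e; ring.
  by exists (s' * z); rewrite -mulrA ez; ring.
(* When [g i] is zero the old pivot is kept, so that the pivot stays nonzero. *)
have [gi0|gi] := eqVneq (g i) 0.
  exists j, s; split=> // k; rewrite inE => /orP[/eqP->|/H//].
  by exists 0; rewrite gi0 !mulr0.
exists i, (s' * s); split=> //; first exact: nPM.
move=> k; rewrite inE => /orP[/eqP->|/H[z ez]]; first by exists (s' * s); rewrite mulrC.
by exists (y * z); rewrite -mulrA ez !mulrA e.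
Qed.

(** Among finitely many generators of [J], a nonzero one of least valuation generates [J] at [P]. *)
Lemma local_principal J : is_ideal J -> (exists x, J x /\ x != 0) ->
  exists a s, [/\ J a, a != 0, ~ P s & forall x, J x -> exists y, s * x = a * y].
Proof.
move=> Ji [x [Jx x0]]; have [n [g [Jg gen]]] := ideal_fg_gens (noeth Ji).
have [i gi] : exists i, g i != 0.
  apply: contrapT => /forallNP H; move/eqP: x0; apply.
  have [t ->] := gen _ Jx; apply: big1 => i _.
  by have /negP := H i; rewrite negbK => /eqP->; rewrite mulr0.
have [j [s [ns gj /choice[y Hy]]]] := local_dvd_min gi.
exists (g j), s; split=> // z /gen[t ->].
exists (\sum_i t i * y i); rewrite !mulr_sumr; apply: eq_bigr => k _.
by rewrite mulrCA Hy mulrCA.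
Qed.

(** * Finitely generated modules near [P]: free part and torsion part *)

Definition torsion_elt (L : lmodType R) (z : L) := exists b, b != 0 /\ b *: z = 0.

Lemma torsion_eltD (L : lmodType R) (z w : L) :
  torsion_elt z -> torsion_elt w -> torsion_elt (z + w).
Proof.
move=> [b [b0 bz]] [c [c0 cw]]; exists (b * c); split; first by rewrite mulf_neq0.
by rewrite scalerDr [in X in X + _]mulrC -!scalerA bz cw !scaler0 addr0.
Qed.

Lemma torsion_eltZ (L : lmodType R) r (z : L) : torsion_elt z -> torsion_elt (r *: z).
Proof. by move=> [b [b0 bz]]; exists b; split=> //; rewrite scalerA mulrC -scalerA bz scaler0. Qed.

(* Modulo torsion and after inverting the elements outside [P], a minimal
   generating family is free, because a relation can be divided by its
   coefficient of least valuation and solved for that generator. *)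
Lemma local_free_mod_torsion (L : lmodType R) : module_fg L ->
  exists s n (alpha : 'I_n -> L -> R^o) (l : 'I_n -> L),
    [/\ ~ P s, forall i, linear (alpha i) &
        forall x : L, torsion_elt (s *: x - \sum_i alpha i x *: l i)].
Proof.
move=> /module_fg_gens[n [g gen]].
have : exists s, ~ P s /\ forall x : L, exists t : 'I_n -> R,
    torsion_elt (s *: x - \sum_i t i *: g i).
  exists 1; split=> // x; have [t ->] := gen x; exists t, 1.
  by rewrite oner_eq0 !scale1r subrr.
elim: n g {gen} => [|n IH] g [s [ns span]].
  exists s, 0%N, (fun _ _ => 0), g; split=> // [[]//|x].
  by have [t] := span x; rewrite !big_ord0.
have [[r [[i ri] rel]]|indep] :=
  EM (exists r : 'I_n.+1 -> R, (exists i, r i != 0) /\ \sum_i r i *: g i = 0).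
  have [j [u [nu rj /choice[y Hy]]]] := local_dvd_min ri.
  apply: (IH (fun i => g (lift j i))); exists (u * s); split; first exact: nPM.
  move=> x; have [t tx] := span x.
  exists (fun i => u * t (lift j i) - t j * y (lift j i)).
  (* [u] times the relation is divisible by [r j], which expresses [u *: g j] through the other
     generators up to torsion. *)
  have trel : torsion_elt (u *: g j + \sum_i y (lift j i) *: g (lift j i)).
    exists (r j); split=> //.
    have := congr1 (fun z => u *: z) rel; rewrite scaler0 (bigD1_ord j) //= => e; apply: etrans e.
    rewrite !scalerDr !scaler_sumr !scalerA [r j * u]mulrC; congr (_ + _).
    by apply: eq_bigr => k _; rewrite !scalerA Hy.
  have := torsion_eltD (torsion_eltZ u tx) (torsion_eltZ (t j) trel); congr torsion_elt.
  rewrite (bigD1_ord j) //= scalerBr !scalerDr !scaler_sumr !scalerA.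
  rewrite opprD addrA [t j * u]mulrC -!addrA; congr (_ + _).
  rewrite addrCA addKr -!sumrN -big_split; apply: eq_bigr => k _ /=.
  by rewrite scalerBl opprB !scalerA addrC.
(* With no relation left, the coefficients of [s *: x] are determined by [x], hence linear in
   [x]. *)
have uniq (x : L) (t t' : 'I_n.+1 -> R) : torsion_elt (s *: x - \sum_i t i *: g i) ->
    torsion_elt (s *: x - \sum_i t' i *: g i) -> t =1 t'.
  move=> tx /(torsion_eltZ (-1)) /(torsion_eltD tx).
  rewrite scaleN1r opprB addrC subrKA -sumrB => -[b [b0 e]] i; apply/eqP; rewrite -subr_eq0.
  apply: contrapT => /negP ti; apply: indep; exists (fun i => b * (t' i - t i)); split.
    by exists i; rewrite mulf_neq0 // -oppr_eq0 opprB.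
  by apply: etrans e; rewrite scaler_sumr; apply: eq_bigr => k _; rewrite -scalerBl scalerA.
have [T HT] := choice span.
exists s, n.+1, (fun i (x : L) => T x i), g; split=> // i a x y.
apply: (uniq (a *: x + y) _ (fun i => a * T x i + T y i)) => //.
have := torsion_eltD (torsion_eltZ a (HT x)) (HT y); congr torsion_elt.
rewrite scalerBr scalerDr addrACA !scalerA -opprD [a * s]mulrC; congr (_ - _).
rewrite scaler_sumr -big_split; apply: eq_bigr => k _.
by rewrite scalerDl scalerA.
Qed.

(** A single nonzero [B] kills the torsion parts of all generators. As [a] is in [P], some power of
    [a] is divisible by [B] up to a factor [s'] outside [P], which is absorbed into [s] and
    [alpha]. *)
Lemma local_splitting (L : lmodType R) a : module_fg L -> P a -> a != 0 ->
  exists s c n (alpha : 'I_n -> L -> R^o) (l : 'I_n -> L),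
    [/\ ~ P s, forall i, linear (alpha i) &
        forall x : L, a ^+ c *: (s *: x - \sum_i alpha i x *: l i) = 0].
Proof.
move=> fgL Pa a0; have [s [n [alpha [l [ns al tors]]]]] := local_free_mod_torsion fgL.
have [k [g gen]] := module_fg_gens fgL.
pose beta (x : L) := s *: x - \sum_i alpha i x *: l i.
have bl : linear beta by apply: linear_defect.
have /choice[b Hb] : forall i, exists b, b != 0 /\ b *: beta (g i) = 0 by move=> i; apply: tors.
pose B := \prod_i b i.
have B0 : B != 0 by apply/prodf_neq0 => i _; case: (Hb i).
have Bbeta (x : L) : B *: beta x = 0.
  have [t ->] := gen x; rewrite lin_sum // scaler_sumr big1 // => i _.
  rewrite linZ // /B (bigD1 i) //= scalerA mulrC mulrCA mulrC -!scalerA.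
  by case: (Hb i) => _ ->; rewrite !scaler0.
have [c [s' [y [ns' e]]]] := local_expr_dvd B0 Pa.
exists (s' * s), c, n, (fun i (x : L) => s' * alpha i x), l; split; first exact: nPM.
  by move=> i r x z; rewrite al mulrDr /GRing.scale /= mulrCA.
move=> x; have -> : (s' * s) *: x - \sum_i (s' * alpha i x) *: l i = s' *: beta x.
  by rewrite scalerBr scalerA scaler_sumr; under eq_bigr => i _ do rewrite -scalerA.
by rewrite scalerA mulrC e mulrC -scalerA Bbeta scaler0.
Qed.

End LocalizationAtPrime.

(** * Powers of ideals, the submodules they generate, and quotient modules *)

Section IdealPowers.
Variable R : comNzRingType.
Implicit Types (I J K : R -> Prop).

Lemma ideal_mul_sub I J K : is_ideal K -> (forall x y, I x -> J y -> K (x * y)) ->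
  forall x, ideal_mul I J x -> K x.
Proof.
move=> Ki IJK x [s [sIJ ->]]; elim: s sIJ => [|p s IH] sIJ.
  by rewrite big_nil; apply: ideal0.
rewrite big_cons; apply: idealD => //.
  by have [] := sIJ p; rewrite ?mem_head //; apply: IJK.
by apply: IH => q qs; apply: sIJ; rewrite inE qs orbT.
Qed.

Lemma ideal_mulM I J x y : I x -> J y -> ideal_mul I J (x * y).
Proof.
move=> Ix Jy; exists [:: (x, y)]; rewrite big_seq1; split=> // p.
by rewrite inE => /eqP->.
Qed.

Lemma is_ideal_mul I J : is_ideal I -> is_ideal (ideal_mul I J).
Proof.
move=> Ii; split.
- by exists [::]; rewrite big_nil.
- move=> x y [s [sIJ ->]] [t [tIJ ->]]; exists (s ++ t); rewrite big_cat; split=> // p.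
  by rewrite mem_cat => /orP[/sIJ|/tIJ].
- move=> r x [s [sIJ ->]]; exists [seq (r * p.1, p.2) | p <- s]; split.
    by move=> _ /mapP[p /sIJ[Ip Jp] ->]; split=> //; apply: idealZ.
  by rewrite big_map mulr_sumr; apply: eq_bigr => p _; rewrite mulrA.
Qed.

Lemma is_ideal_pow I n : is_ideal I -> is_ideal (ideal_pow I n).
Proof. by case: n => [|n] Ii //=; apply: is_ideal_mul. Qed.

Lemma ideal_pow_le I m n x : is_ideal I -> (m <= n)%N -> ideal_pow I n x -> ideal_pow I m x.
Proof.
move=> Ii /subnK <-; elim: (n - m)%N => // k IH /=.
rewrite -/(ideal_pow I (k + m)) => H; apply: IH; move: H.
apply: ideal_mul_sub; first exact: is_ideal_pow.
by move=> y z _; apply: idealZ; apply: is_ideal_pow.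
Qed.

Lemma ideal_pow_exprM I k n a x : I a -> ideal_pow I n x -> ideal_pow I (k + n) (a ^+ k * x).
Proof.
move=> Ia Ix; elim: k => [|k IH]; first by rewrite mul1r.
by rewrite exprS -mulrA addSn; apply: ideal_mulM.
Qed.

Lemma ideal_pow_expr I n a : I a -> ideal_pow I n (a ^+ n).
Proof. by move=> Ia; have := @ideal_pow_exprM I n 0 a 1 Ia; rewrite addn0 mulr1; apply. Qed.

(** Each of the [n] factors from [I] becomes a multiple of [a] at the cost of one [s]. *)
Lemma ideal_pow_principal I a s n x : (forall x, I x -> exists y, s * x = a * y) ->
  ideal_pow I n x -> exists y, s ^+ n * x = a ^+ n * y.
Proof.
move=> sI; elim: n x => [|n IH] x; first by exists x.
apply: (ideal_mul_sub (K := fun x => exists y, s ^+ n.+1 * x = a ^+ n.+1 * y)).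
  split=> [|y z [y' ey] [z' ez]|r y [y' ey]].
  - by exists 0; rewrite !mulr0.
  - by exists (y' + z'); rewrite !mulrDr ey ez.
  - by exists (r * y'); rewrite mulrCA ey mulrCA.
move=> y z /sI[y' ey] /IH[z' ez]; exists (y' * z').
by rewrite !exprS mulrACA ey ez mulrACA.
Qed.

Variable M : lmodType R.
Implicit Type m : M.

Lemma ideal_smul_sub J (K : M -> Prop) : K 0 -> (forall m m', K m -> K m' -> K (m + m')) ->
  (forall r m, J r -> K (r *: m)) -> forall m, ideal_smul J M m -> K m.
Proof.
move=> K0 KD KZ m [s [sJ ->]]; elim: s sJ => [|p s IH] sJ; first by rewrite big_nil.
rewrite big_cons; apply: KD; first by apply: KZ; apply: sJ; rewrite mem_head.
by apply: IH => q qs; apply: sJ; rewrite inE qs orbT.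
Qed.

Lemma ideal_smulZ J r m : J r -> ideal_smul J M (r *: m).
Proof.
by move=> Jr; exists [:: (r, m)]; rewrite big_seq1; split=> // p; rewrite inE => /eqP->.
Qed.

Lemma ideal_smul0 J : ideal_smul J M 0.
Proof. by exists [::]; rewrite big_nil. Qed.

Lemma ideal_smulD J m m' : ideal_smul J M m -> ideal_smul J M m' -> ideal_smul J M (m + m').
Proof.
move=> [s [sJ ->]] [t [tJ ->]]; exists (s ++ t); rewrite big_cat; split=> // p.
by rewrite mem_cat => /orP[/sJ|/tJ].
Qed.

Lemma ideal_smul_scale J J' a m : (forall r, J r -> J' (a * r)) ->
  ideal_smul J M m -> ideal_smul J' M (a *: m).
Proof.
move=> JJ'; apply: (ideal_smul_sub (K := fun m => ideal_smul J' M (a *: m))).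
- by rewrite scaler0; apply: ideal_smul0.
- by move=> x y; rewrite scalerDr; apply: ideal_smulD.
- by move=> r x /JJ' Jr; rewrite scalerA; apply: ideal_smulZ.
Qed.

Lemma linear_ideal_smul J (f : M -> R^o) m : is_ideal J -> linear f ->
  ideal_smul J M m -> J (f m).
Proof.
move=> Ji fl; apply: (ideal_smul_sub (K := fun m => J (f m))).
- by rewrite lin0 //; apply: ideal0.
- by move=> x y; rewrite linD //; apply: idealD.
- by move=> r x Jr; rewrite linZ // /GRing.scale /= mulrC; apply: idealZ.
Qed.

(** The induced map is selected from the relation between [p m] and [h m]. *)
Lemma quotient_descend (Q X : lmodType R) (K : M -> Prop) (p : M -> Q) (h : M -> X) :
  is_quotient K p -> linear h -> (forall m, K m -> h m = 0) ->
  exists h' : Q -> X, linear h' /\ forall m, h' (p m) = h m.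
Proof.
move=> [pl ps pK] hl hK.
have [||| f [fl Hf]] := @linear_selection R Q X (fun q x => exists m, p m = q /\ h m = x).
- by move=> q; have [m <-] := ps q; exists (h m), m.
- by move=> r _ _ _ _ [m [<- <-]] [m' [<- <-]]; exists (r *: m + m'); rewrite pl hl.
- by move=> _ [m [/pK/hK e <-]].
exists f; split=> // m; have [m' [/eqP em <-]] := Hf (p m).
have : p (m' - m) = 0 by rewrite linB // (eqP em) subrr.
by move=> /pK/hK; rewrite linB // => /eqP; rewrite subr_eq0 => /eqP.
Qed.

End IdealPowers.

(** * Linear functors *)

Section LinearFunctor.
Variables (R : idomainType) (F : fg_functor R).
Hypothesis linF : is_linear_functor F.

Lemma fmap_linear (M N : lmodType R) (f : M -> N) :
  module_fg M -> module_fg N -> linear f -> linear (fmap (f := F) f).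
Proof. by case: linF => _ + _ _ _; apply. Qed.

Lemma fmap_id (M : lmodType R) y : module_fg M -> fmap (f := F) (fun x : M => x) y = y.
Proof. by case: linF => _ _ [_ +] _ _ fgM; apply. Qed.

Lemma fmap_scale (M : lmodType R) r y : module_fg M ->
  fmap (f := F) (fun x : M => r *: x) y = r *: y.
Proof.
move=> fgM; have idl : linear (fun x : M => x) by [].
case: linF => _ _ _ _ add.
(* Linearity of [F] is stated for maps [r *: f + g]; here [f] and [g] are both the identity. *)
have -> : (fun x : M => r *: x) = (fun x => (r - 1) *: x + x).
  by apply/funext => x; rewrite scalerBl scale1r subrK.
by rewrite add // fmap_id // scalerBl scale1r subrK.
Qed.

(** [r] acts on [F M] as the image of multiplication by [r] on [M], which is here multiplication by
    [0]. *)
Lemma fobj_annihilator (M : lmodType R) r y : module_fg M ->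
  (forall x : M, r *: x = 0) -> r *: (y : fobj F M) = 0.
Proof.
move=> fgM rM; rewrite -fmap_scale //.
have -> : (fun x : M => r *: x) = (fun x => 0 *: x).
  by apply/funext => x; rewrite rM scale0r.
by rewrite fmap_scale // scale0r.
Qed.

Lemma fmap_cancel (M N : lmodType R) (f : M -> N) (g : N -> M) :
  module_fg M -> module_fg N -> linear f -> linear g -> cancel f g ->
  cancel (fmap (f := F) f) (fmap (f := F) g).
Proof.
move=> fgM fgN fl gl fK y; case: linF => _ _ _ comp _.
rewrite -comp //; have -> : (fun x => g (f x)) = id by apply/funext.
exact: fmap_id.
Qed.

Lemma assoc_prime_injective (M N : lmodType R) (f : M -> N) (P : R -> Prop) :
  linear f -> injective f -> is_assoc_prime M P -> is_assoc_prime N P.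
Proof.
move=> fl fi [Pp [x Px]]; split=> //; exists (f x) => r; rewrite Px -(linZ r x fl).
by split=> [->|]; [rewrite lin0|rewrite -[X in _ = X](lin0 fl) => /fi].
Qed.

End LinearFunctor.

(** * Vanishing of a module at a prime, compared with associated primes *)

Definition locally_null (R : comNzRingType) (P : R -> Prop) (N : lmodType R) :=
  forall z : N, exists s, ~ P s /\ s *: z = 0.

Lemma locally_null_not_assoc (R : comNzRingType) (P : R -> Prop) (N : lmodType R) :
  locally_null P N -> ~ is_assoc_prime N P.
Proof. by move=> nullN [_ [x Px]]; have [s [nPs /Px]] := nullN x. Qed.

(** With [s * P ^ j] inside [J], the power [P ^ j] kills [s *: z]. If [z] survives at [P], then
    [s *: z] is nonzero and has a multiple with annihilator [P]. *)
Lemma not_assoc_locally_null (R : idomainType) (P J : R -> Prop) (N : lmodType R) :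
  dedekind_domain R -> is_prime_ideal P -> (exists x, P x /\ x != 0) ->
  is_ideal J -> (exists x, J x /\ x != 0) -> (forall r (z : N), J r -> r *: z = 0) ->
  ~ is_assoc_prime N P -> locally_null P N.
Proof.
move=> dedR Pp Pn0 Ji Jn0 JN nass z; apply: contrapT => /forallNP H.
have [j [s [nPs Hs]]] := prime_power_sub dedR Pp Ji Jn0.
have [||||t tP|t Ht] := @prime_annihilator_multiple R P dedR Pp Pn0 N (fun x => x = 0) (s *: z) j.
- by [].
- by move=> _ _ -> ->; rewrite addr0.
- by move=> r _ ->; rewrite scaler0.
- by move=> sz; apply: (H s).
- by move=> ?; rewrite scalerA mulrC; apply/JN/Hs.
by apply: nass; split=> //; exists (t *: (s *: z)).
Qed.

(** * Vanishing of [F (Q n)] at [P] deduced from smaller and larger indices *)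

Section Interpolation.
Variables (R : idomainType) (P I : R -> Prop) (M L : lmodType R) (F : fg_functor R).
Variables (Q : nat -> lmodType R) (pi : forall n, M -> Q n).
Variable eta : forall X : lmodType R, (L -> X) -> fobj F X.
Hypotheses (primeP : is_prime_ideal P) (idealI : is_ideal I) (fgM : module_fg M).
Hypothesis linF : is_linear_functor F.
Hypothesis eta_lin : forall (X : lmodType R) (f g : L -> X) (r : R),
  module_fg X -> linear f -> linear g ->
  eta (fun x => r *: f x + g x) = r *: eta f + eta g.
Hypothesis eta_nat : forall (X Y : lmodType R) (f : L -> X) (h : X -> Y),
  module_fg X -> module_fg Y -> linear f -> linear h ->
  eta (fun x => h (f x)) = fmap h (eta f).
Hypothesis eta_surj : forall X : lmodType R, module_fg X -> forall y : fobj F X,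
  exists f : L -> X, linear f /\ eta f = y.
Hypothesis quoQ : forall n, (1 <= n)%N -> is_quotient (ideal_smul (ideal_pow I n) M) (pi n).

Let nPM s u : ~ P s -> ~ P u -> ~ P (s * u).
Proof. by case: primeP => _ _ H ns nu /H[]. Qed.
Let nPX s n : ~ P s -> ~ P (s ^+ n).
Proof. by move=> ns /(prime_expr primeP). Qed.
Let pi_lin n : (1 <= n)%N -> linear (pi n).
Proof. by move=> /quoQ[]. Qed.
Let pi_surj n q : (1 <= n)%N -> exists m, pi n m = q.
Proof. by move=> /quoQ[_ + _]; apply. Qed.
Let pi_ker n m : (1 <= n)%N -> pi n m = 0 <-> ideal_smul (ideal_pow I n) M m.
Proof. by move=> /quoQ[_ _]; apply. Qed.
Let fgQ n : (1 <= n)%N -> module_fg (Q n).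
Proof. by move=> n1; apply: module_fg_image fgM; [apply: pi_lin|move=> q; apply: pi_surj]. Qed.

(** The element of [F X] represented by [f] vanishes at [P]. Sums preserve this and a factor outside
    [P] can be removed, so [f] may be cut into pieces. *)
Definition null_map (X : lmodType R) (f : L -> X) := exists s, ~ P s /\ s *: eta f = 0.

Lemma eta_zero (X : lmodType R) : module_fg X -> eta (fun _ : L => 0 : X) = 0.
Proof.
move=> fgX; have zl : linear (fun _ : L => 0 : X) by move=> r x y; rewrite scaler0 addr0.
rewrite -(addNr (eta (fun _ : L => 0 : X))) -scaleN1r -eta_lin //.
by congr eta; apply/funext => x; rewrite scaler0 addr0.
Qed.

Lemma eta_scale (X : lmodType R) r (f : L -> X) : module_fg X -> linear f ->
  eta (fun x => r *: f x) = r *: eta f.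
Proof.
move=> fgX fl; have zl : linear (fun _ : L => 0 : X) by move=> k x y; rewrite scaler0 addr0.
rewrite -[RHS]addr0 -(eta_zero fgX) -eta_lin //.
by congr eta; apply/funext => x; rewrite addr0.
Qed.

Lemma null_map_add (X : lmodType R) (f g : L -> X) : module_fg X -> linear f -> linear g ->
  null_map f -> null_map g -> null_map (fun x => f x + g x).
Proof.
move=> fgX fl gl [s [ns sf]] [u [nu ug]]; exists (s * u); split; first exact: nPM.
have -> : (fun x => f x + g x) = (fun x => 1 *: f x + g x).
  by apply/funext => x; rewrite scale1r.
rewrite eta_lin // scale1r scalerDr [in X in X + _]mulrC -!scalerA sf ug.
by rewrite !scaler0 addr0.
Qed.

Lemma null_map_sum (X : lmodType R) (T : Type) (l : seq T) (f : T -> L -> X) :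
  module_fg X -> (forall i, linear (f i)) -> (forall i, null_map (f i)) ->
  null_map (fun x => \sum_(i <- l) f i x).
Proof.
move=> fgX fl nf; elim: l => [|i l IH].
  exists 1; split; first by case: primeP.
  rewrite scale1r -(eta_zero fgX); congr eta.
  by apply/funext => x; rewrite big_nil.
have -> : (fun x => \sum_(j <- i :: l) f j x) = (fun x => f i x + \sum_(j <- l) f j x).
  by apply/funext => x; rewrite big_cons.
by apply: null_map_add => //; apply: (linear_bigsum l fl).
Qed.

Lemma null_map_unscale (X : lmodType R) s (f : L -> X) : module_fg X -> linear f ->
  ~ P s -> null_map (fun x => s *: f x) -> null_map f.
Proof.
move=> fgX fl ns [u [nu e]]; exists (u * s); split; first exact: nPM.
by rewrite -scalerA -eta_scale.
Qed.

(** By naturality [eta (h \o g)] is the image of [eta g], which vanishes at [P]. *)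
Lemma null_map_factor (X Y : lmodType R) (g : L -> X) (h : X -> Y) :
  module_fg X -> module_fg Y -> linear g -> linear h -> locally_null P (fobj F X) ->
  null_map (fun x => h (g x)).
Proof.
move=> fgX fgY gl hl nX; have [s [ns e]] := nX (eta g); exists s; split=> //.
have fh := fmap_linear linF fgX fgY hl.
by rewrite eta_nat // -linZ // e lin0.
Qed.

(** Multiplication by [a ^ (n - k)] carries [I ^ k M] into [I ^ n M]. *)
Lemma quotient_multiplication a k n : I a -> (1 <= k <= n)%N ->
  exists psi : Q k -> Q n, linear psi /\ forall m, psi (pi k m) = pi n (a ^+ (n - k) *: m).
Proof.
move=> Ia /andP[k1 kn]; have n1 := leq_trans k1 kn.
apply: (quotient_descend (h := fun m => pi n (a ^+ (n - k) *: m)) (quoQ k1)).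
  by move=> r x y; rewrite scalerDr -(pi_lin n1) scalerA mulrC -scalerA.
move=> m km; apply/pi_ker => //; apply: ideal_smul_scale km => r Ir.
by rewrite -[in ideal_pow I n](subnK kn); apply: ideal_pow_exprM.
Qed.

Lemma quotient_projection k n : (1 <= k <= n)%N ->
  exists theta : Q n -> Q k, linear theta /\ forall m, theta (pi n m) = pi k m.
Proof.
move=> /andP[k1 kn]; have n1 := leq_trans k1 kn.
apply: (quotient_descend (h := pi k) (quoQ n1)); first exact: pi_lin.
move=> m nm; apply/pi_ker => //; rewrite -[m]scale1r; apply: ideal_smul_scale nm => r Ir.
by rewrite mul1r; apply: ideal_pow_le Ir.
Qed.

(** * Local data at [P]: a generator [a] of [I] and splittings of [M] and [L] *)

Variables (a s : R).
Hypotheses (Ia : I a) (a_neq0 : a != 0) (nPs : ~ P s)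
  (sI : forall x, I x -> exists y, s * x = a * y).
Variables (sM : R) (cM nM : nat) (alM : 'I_nM -> M -> R^o) (gM : 'I_nM -> M).
Hypotheses (nPsM : ~ P sM) (alM_lin : forall i, linear (alM i))
  (splitM : forall x : M, a ^+ cM *: (sM *: x - \sum_i alM i x *: gM i) = 0).
Variables (sL : R) (cL nL : nat) (alL : 'I_nL -> L -> R^o) (gL : 'I_nL -> L).
Hypotheses (nPsL : ~ P sL) (alL_lin : forall i, linear (alL i))
  (splitL : forall x : L, a ^+ cL *: (sL *: x - \sum_i alL i x *: gL i) = 0).

(** After multiplication by [s ^ n * sM], [f] is a sum of maps through [Q k]: each free coordinate
    goes through [phi i] and then [psi], the torsion part through [theta] and then [gam]. *)
Lemma null_map_killed k n (f : L -> Q n) :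
  (1 <= k <= n)%N -> (cL <= k)%N -> (cM <= k)%N -> linear f ->
  (forall x, a ^+ cL *: f x = 0) -> locally_null P (fobj F (Q k)) -> null_map f.
Proof.
move=> /andP[k1 kn] cLk cMk fl af nullk; have n1 := leq_trans k1 kn.
have k1n : (1 <= k <= n)%N by rewrite k1.
have aX j : a ^+ j != 0 by rewrite expf_neq0.
have [psi [psil psiE]] := quotient_multiplication Ia k1n.
have [theta [thetal thetaE]] := quotient_projection k1n.
(* Since [a ^ cL *: y] is in [I ^ n M], its coordinates lie in [I ^ n], generated at [P] by [a ^ n];
   cancelling [a ^ cL] leaves [a ^ (n - cL)]. *)
have key y x : pi n y = f x -> forall i, exists r, s ^+ n * alM i y = a ^+ (n - cL) * r.
  move=> yx i; have : ideal_pow I n (alM i (a ^+ cL *: y)).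
    apply: linear_ideal_smul => //; first exact: is_ideal_pow.
    by apply/pi_ker => //; rewrite linZ ?yx ?af //; apply: pi_lin.
  move=> /(ideal_pow_principal sI)[r er]; exists r; apply: (mulfI (aX cL)).
  rewrite [RHS]mulrA -exprD subnKC ?(leq_trans cLk) // -er linZ // /GRing.scale /=.
  by rewrite mulrCA.
(* [psi \o phi i] is [s ^ n] times the [i]-th free component of [f]: this component is
   divisible by [a ^ (n - cL)] because [a ^ cL] kills [f], hence by [a ^ (n - k)]. *)
have /choice[phi phiP] : forall i, exists phi : L -> Q k, linear phi /\
    forall x, exists y r, [/\ pi n y = f x, s ^+ n * alM i y = a ^+ (n - cL) * r &
                             phi x = pi k ((a ^+ (k - cL) * r) *: gM i)].
  move=> i; apply: (linear_selection (G := fun x q => exists y r,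
    [/\ pi n y = f x, s ^+ n * alM i y = a ^+ (n - cL) * r &
         q = pi k ((a ^+ (k - cL) * r) *: gM i)])).
  - move=> x; have [y yx] := pi_surj (f x) n1; have [r er] := key _ _ yx i.
    by exists (pi k ((a ^+ (k - cL) * r) *: gM i)), y, r.
  - move=> b x q x' q' [y [r [yx er ->]]] [y' [r' [yx' er' ->]]].
    exists (b *: y + y'), (b * r + r'); split.
    + by rewrite pi_lin // yx yx' fl.
    + by rewrite alM_lin mulrDr er' /GRing.scale /= mulrCA er; ring.
    + by rewrite -pi_lin // scalerA -scalerDl; congr (pi k (_ *: _)); ring.
  (* Independence of the lift: for [y] in [I ^ n M] the quotient [r] is a multiple of [a ^ cL], so
     the value has a coefficient divisible by [a ^ k]. *)
  - move=> q [y [r [+ er ->]]]; rewrite lin0 // => /pi_ker - /(_ n1) y0.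
    have [|r' er'] := ideal_pow_principal sI (n := n) (x := alM i y).
      by apply: linear_ideal_smul y0 => //; apply: is_ideal_pow.
    have -> : r = a ^+ cL * r'.
      apply: (mulfI (aX (n - cL)%N)); rewrite -er er' mulrA -exprD subnK //.
      exact: leq_trans kn.
    apply/pi_ker => //; apply: ideal_smulZ; rewrite mulrA -exprD subnK // mulrC.
    by apply: idealZ; [apply: is_ideal_pow|apply: ideal_pow_expr].
pose beta (x : M) := sM *: x - \sum_i alM i x *: gM i.
have betal : linear beta by apply: linear_defect.
(* The torsion component of [M] is killed by [a ^ cM], hence, at [P], by [I ^ k]. *)
have [gam [gaml gamE]] : exists gam : Q k -> Q n, linear gam /\
    forall m, gam (pi k m) = pi n (s ^+ n *: beta m).
  apply: (quotient_descend (h := fun m => pi n (s ^+ n *: beta m)) (quoQ k1)).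
    by apply: linear_comp (pi_lin n1); apply: linear_scale.
  move=> m; apply: (ideal_smul_sub (K := fun m => pi n (s ^+ n *: beta m) = 0)).
  - by rewrite (lin0 betal) scaler0 lin0 //; apply: pi_lin.
  - move=> x y ex ey; rewrite (linD _ _ betal) scalerDr linD ?ex ?ey ?addr0 //.
    exact: pi_lin.
  move=> r x /(ideal_pow_principal sI)[y ey].
  have -> : s ^+ n *: beta (r *: x) = 0; last by rewrite lin0 //; apply: pi_lin.
  rewrite (linZ _ _ betal) scalerA -(subnK kn) exprD -mulrA ey.
  rewrite -(subnK cMk) exprD mulrA mulrAC mulrA -scalerA splitM scaler0 //.
have fE x : (s ^+ n * sM) *: f x = \sum_i psi (phi i x) + gam (theta (f x)).
  have [y yx] := pi_surj (f x) n1.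
  rewrite -yx thetaE gamE -linZ; last exact: pi_lin.
  have -> : (s ^+ n * sM) *: y = \sum_i (s ^+ n * alM i y) *: gM i + s ^+ n *: beta y.
    rewrite /beta scalerBr scalerA scaler_sumr.
    by under [in RHS]eq_bigr => i _ do rewrite -scalerA; rewrite addrC subrK.
  rewrite linD; last exact: pi_lin.
  rewrite lin_sum; last exact: pi_lin.
  congr (_ + _); apply: eq_bigr => i _.
  have [phil /(_ x)[y' [r [yx' er ->]]]] := phiP i.
  rewrite psiE scalerA mulrA -exprD addnBA // subnK // -er.
  (* Both [y] and [y'] lift [f x], so their coordinates differ by elements of [I ^ n]. *)
  apply/eqP; rewrite -subr_eq0 -(linB _ _ (pi_lin n1)) -scalerBl -mulrBr.
  rewrite -(linB _ _ (alM_lin i)); apply/eqP/pi_ker => //; apply: ideal_smulZ.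
  apply: idealZ; first exact: is_ideal_pow.
  apply: linear_ideal_smul => //; first exact: is_ideal_pow.
  by apply/pi_ker => //; rewrite linB ?yx ?yx' ?subrr //; apply: pi_lin.
have nsM : ~ P (s ^+ n * sM) by apply: nPM => //; apply: nPX.
apply: (null_map_unscale (fgQ n1) fl nsM).
have -> : (fun x => (s ^+ n * sM) *: f x) =
    (fun x => \sum_i psi (phi i x) + gam (theta (f x))) by apply/funext.
have phil i : linear (phi i) by case: (phiP i).
have psil' i : linear (fun x => psi (phi i x)) by apply: linear_comp.
have thetafl : linear (fun x => theta (f x)) by apply: linear_comp.
apply: null_map_add; first exact: fgQ.
- exact: linear_bigsum.
- exact: linear_comp.
- apply: null_map_sum => //; first exact: fgQ.
  by move=> i; apply: null_map_factor => //; apply: fgQ.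
- by apply: (null_map_factor (g := fun x => theta (f x))) => //; apply: fgQ.
Qed.

Lemma locally_null_between k n m : (1 <= k <= n)%N -> (n <= m)%N ->
  (cL <= k)%N -> (cM <= k)%N ->
  locally_null P (fobj F (Q k)) -> locally_null P (fobj F (Q m)) ->
  locally_null P (fobj F (Q n)).
Proof.
move=> k1n nm cLk cMk nullk nullm z; have /andP[k1 kn] := k1n.
have n1 := leq_trans k1 kn; have m1 := leq_trans n1 nm.
have [f [fl <-]] := eta_surj (fgQ n1) z.
suff : null_map f by [].
apply: (null_map_unscale (fgQ n1) fl nPsL).
pose beta (x : L) := sL *: x - \sum_i alL i x *: gL i.
have betal : linear beta by apply: linear_defect.
(* The splitting of [L] cuts [f] into rank-one maps and a map killed by [a ^ cL]. *)
have -> : (fun x => sL *: f x) = (fun x => \sum_i alL i x *: f (gL i) + f (beta x)).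
  apply/funext => x; rewrite -linZ // -[sL *: x](subrK (\sum_i alL i x *: gL i)).
  rewrite addrC linD // lin_sum //; congr (_ + _).
  by apply: eq_bigr => i _; rewrite linZ.
have fbl : linear (fun x => f (beta x)) by apply: linear_comp.
have all i : linear (fun x => alL i x *: f (gL i)) by apply: linear_scale_vec.
apply: null_map_add => //; first exact: fgQ.
- exact: linear_bigsum.
- apply: null_map_sum => //; first exact: fgQ.
  move=> i; have n1m : (1 <= n <= m)%N by rewrite n1.
  have [theta [thetal thetaE]] := quotient_projection n1m.
  have [y ey] := pi_surj (f (gL i)) n1.
  (* A rank-one map lifts to [Q m] as soon as the vector [f (gL i)] does. *)
  have -> : (fun x => alL i x *: f (gL i)) = (fun x => theta (alL i x *: pi m y)).
    by apply/funext => x; rewrite linZ // thetaE ey.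
  apply: (null_map_factor (g := fun x => alL i x *: pi m y)) => //; try exact: fgQ.
  exact: linear_scale_vec.
- apply: (null_map_killed k1n cLk cMk fbl) => // x.
  by rewrite -linZ // splitL lin0.
Qed.

End Interpolation.

(** * Primes over a nonzero ideal, and eventually constant predicates *)

Lemma prod_sub_prime (R : comNzRingType) (l : seq (R -> Prop)) (J P : R -> Prop) :
  is_prime_ideal P -> prod_sub l J -> (forall x, J x -> P x) ->
  exists2 Q, List.In Q l & forall x, Q x -> P x.
Proof.
move=> Pp; elim: l J => [|Q l IH] J pl JP.
  have /JP := pl [::] (List.Forall2_nil _); rewrite big_nil.
  by case: Pp.
have [QP|nQP] := EM (forall x, Q x -> P x); first by exists Q; first left.
have [x /not_implyP[Qx nPx]] : exists x, ~ (Q x -> P x) by apply/existsNP.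
(* As [x] is outside the prime [P], the colon of [J] by [x] is still contained in [P]. *)
have [||Q' Q'l Q'P] := IH (fun y => J (x * y)); last by exists Q'; first right.
- by move=> t Ht; rewrite -prod_cons; apply: pl; constructor.
- by move=> y /JP; case: Pp => _ _ H /H[].
Qed.

(** [I] contains a product of nonzero primes; a prime over [I] contains one of the factors and
    equals it by maximality. *)
Lemma dedekind_finite_primes_over (R : idomainType) (I : R -> Prop) :
  dedekind_domain R -> is_ideal I -> (exists x, I x /\ x != 0) ->
  exists l : seq (R -> Prop), forall P, is_prime_ideal P -> (forall x, I x -> P x) ->
    List.In P l.
Proof.
move=> dedR Ii In0; have [noeth _ maxi] := dedR.
have [l [/List.Forall_forall Hl pl]] := primes_product_sub noeth Ii In0.
exists l => P Pp IP; have [Q Ql QP] := prod_sub_prime Pp pl IP.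
have [Qp Qn0] := Hl Q Ql; have [Pi nP1 _] := Pp.
by rewrite (maximal_eq (maxi Q Qp Qn0) Pi QP nP1).
Qed.

(** Beyond [c], either [A] always holds, or it fails from some [k] on, or it fails at [k] and holds
    at a later [n], after which it cannot fail again. *)
Lemma eventually_constant_between (A : nat -> Prop) c :
  (forall k n m, (c <= k)%N -> (k <= n)%N -> (n <= m)%N -> ~ A k -> ~ A m -> ~ A n) ->
  exists2 n0, (c <= n0)%N & forall n, (n0 <= n)%N -> (A n <-> A n0).
Proof.
move=> btw; have [allA|] := EM (forall k, (c <= k)%N -> A k).
  by exists c => // n cn; split=> _; apply: allA.
move=> /existsNP[k /not_implyP[ck nAk]].
have [noA|] := EM (forall n, (k <= n)%N -> ~ A n).
  by exists k => // n kn; split=> [/(noA n kn)|/nAk].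
move=> /existsNP[n /not_implyP[kn /contrapT An]]; exists n; first exact: leq_trans kn.
move=> m nm; split=> // _; apply: contrapT => nAm; exact: (btw k n m).
Qed.

(** * Associated primes of [F (Q n)] *)

Section AssociatedPrimes.
Variables (R : idomainType) (I : R -> Prop) (M : lmodType R) (F : fg_functor R).
Variables (Q : nat -> lmodType R) (pi : forall n, M -> Q n).
Hypotheses (idealI : is_ideal I) (fgM : module_fg M) (linF : is_linear_functor F).
Hypothesis quoQ : forall n, (1 <= n)%N -> is_quotient (ideal_smul (ideal_pow I n) M) (pi n).

Lemma module_fg_quotient n : (1 <= n)%N -> module_fg (Q n).
Proof. by move=> /quoQ[pl ps _]; apply: module_fg_image fgM. Qed.

Lemma fobj_quotient_annihilator n r (y : fobj F (Q n)) : (1 <= n)%N ->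
  ideal_pow I n r -> r *: y = 0.
Proof.
move=> n1 Ir; apply: fobj_annihilator => // [|q]; first exact: module_fg_quotient.
have [pl ps pK] := quoQ n1; have [m <-] := ps q.
by rewrite -linZ //; apply/pK/ideal_smulZ.
Qed.

Lemma assoc_prime_contains n P : (1 <= n)%N -> is_assoc_prime (fobj F (Q n)) P ->
  forall x, I x -> P x.
Proof.
move=> n1 [Pp [y Py]] x Ix; apply: (prime_expr (n := n) Pp); apply/Py.
by apply: fobj_quotient_annihilator => //; apply: ideal_pow_expr.
Qed.

(** All [I ^ k M] with [k >= 1] are zero, so the projections of [M] induce mutually inverse maps
    between [Q n] and [Q m]. *)
Lemma assoc_prime_zero_ideal n m P : (1 <= n)%N -> (1 <= m)%N -> (forall x, I x -> x = 0) ->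
  is_assoc_prime (fobj F (Q n)) P -> is_assoc_prime (fobj F (Q m)) P.
Proof.
move=> n1 m1 I0.
have IM0 k (z : M) : (1 <= k)%N -> ideal_smul (ideal_pow I k) M z -> z = 0.
  move=> k1; apply: (ideal_smul_sub (K := fun z => z = 0)) => // [_ _ -> ->|r w Ir].
    by rewrite addr0.
  (* The zero ideal is generated by [a = 0] with [s = 1], and [0 ^+ k = 0] because [k >= 1]. *)
  have [|y] := @ideal_pow_principal R I 0 1 k r _ Ir.
    by move=> x /I0->; exists 0; rewrite !mulr0.
  by rewrite expr1n expr0n (gtn_eqF k1) mul1r mul0r => ->; rewrite scale0r.
have [pnl pns pnK] := quoQ n1; have [pml pms pmK] := quoQ m1.
have [f [fl fE]] : exists f : Q n -> Q m, linear f /\ forall z, f (pi n z) = pi m z.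
  by apply: (quotient_descend (quoQ n1)) => // z /IM0-> //; rewrite lin0.
have [g [gl gE]] : exists g : Q m -> Q n, linear g /\ forall z, g (pi m z) = pi n z.
  by apply: (quotient_descend (quoQ m1)) => // z /IM0-> //; rewrite lin0.
have fgn := module_fg_quotient n1; have fgm := module_fg_quotient m1.
apply: (assoc_prime_injective (fmap_linear linF fgn fgm fl)).
apply: can_inj (fmap_cancel linF fgn fgm fl gl _).
by move=> q; have [z <-] := pns q; rewrite fE gE.
Qed.

(** Unless [P] is a prime over [I], it is never associated. Otherwise non-association means
    vanishing at [P], since the nonzero ideal [I ^ n] kills [F (Q n)], and vanishing
    interpolates. *)
Lemma assoc_prime_eventually_constant P : dedekind_domain R -> functor_fg F ->
  (exists x, I x /\ x != 0) ->
  exists2 n0, (1 <= n0)%N & forall n, (n0 <= n)%N ->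
    (is_assoc_prime (fobj F (Q n)) P <-> is_assoc_prime (fobj F (Q n0)) P).
Proof.
move=> dedR [L [eta [fgL eta_lin eta_nat _ eta_surj]]] In0.
have [[Pp IP]|nP] := EM (is_prime_ideal P /\ forall x, I x -> P x); last first.
  have nass n : (1 <= n)%N -> ~ is_assoc_prime (fobj F (Q n)) P.
    by move=> n1 ass; apply: nP; split; [case: ass|apply: assoc_prime_contains ass].
  by exists 1%N => // n n1; split=> /nass; case.
have Pn0 : exists x, P x /\ x != 0 by have [x [/IP]] := In0; exists x.
have [a [s [Ia a0 nPs sI]]] := local_principal dedR Pp Pn0 idealI In0.
have [sM [cM [nM [alM [gM [nPsM alM_lin splitM]]]]]] :=
  local_splitting dedR Pp Pn0 fgM (IP _ Ia) a0.
have [sL [cL [nL [alL [gL [nPsL alL_lin splitL]]]]]] :=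
  local_splitting dedR Pp Pn0 fgL (IP _ Ia) a0.
have nullP n : (1 <= n)%N -> ~ is_assoc_prime (fobj F (Q n)) P -> locally_null P (fobj F (Q n)).
  move=> n1; apply: (not_assoc_locally_null (J := ideal_pow I n)) => //.
  - exact: is_ideal_pow.
  - by exists (a ^+ n); split; [apply: ideal_pow_expr|apply: expf_neq0].
  - by move=> r z; apply: fobj_quotient_annihilator.
(* The threshold ensures that [a ^ k] kills the torsion parts of [M] and [L] and that [Q k] is a
   quotient of [M]. *)
have [|n0] := @eventually_constant_between
    (fun n => is_assoc_prime (fobj F (Q n)) P) (maxn 1 (maxn cM cL)).
  move=> k n m; rewrite !geq_max => /and3P[k1 cMk cLk] kn nm /(nullP _ k1) nullk.
  have n1 := leq_trans k1 kn; move=> /(nullP _ (leq_trans n1 nm)) nullm.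
  apply: locally_null_not_assoc.
  by apply: (locally_null_between Pp idealI fgM linF eta_lin eta_nat eta_surj quoQ
    Ia a0 nPs sI nPsM alM_lin splitM nPsL alL_lin splitL _ nm cLk cMk nullk nullm); rewrite k1.
by rewrite geq_max => /andP[n1 _] Hn; exists n0.
Qed.

End AssociatedPrimes.

Theorem theorem4p2 (R : idomainType) (I : R -> Prop) (M : lmodType R)
    (F : fg_functor R)
    (Q : nat -> lmodType R) (pi : forall n, M -> Q n) :
  dedekind_domain R -> is_ideal I -> module_fg M ->
  is_linear_functor F -> functor_fg F ->
  (forall n, (1 <= n)%N ->
     is_quotient (ideal_smul (ideal_pow I n) M) (pi n)) ->
  exists n0 : nat, (1 <= n0)%N /\
    forall n, (n0 <= n)%N ->
      forall P : R -> Prop,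
        is_assoc_prime (fobj F (Q n)) P <-> is_assoc_prime (fobj F (Q n0)) P.
Proof.
move=> dedR idealI fgM linF fgF quoQ.
have [In0|I0] := EM (exists x, I x /\ x != 0); last first.
  exists 1%N; split=> // n n1 P.
  have {}I0 x : I x -> x = 0.
    by move=> Ix; apply/eqP; apply: contrapT => /negP x0; apply: I0; exists x.
  by split; apply: (assoc_prime_zero_ideal fgM linF quoQ).
have [l Hl] := dedekind_finite_primes_over dedR idealI In0.
(* The maximum of the thresholds serves all the finitely many primes over [I] at once. *)
have [n0 n01 Hn0] : exists2 n0, (1 <= n0)%N & forall P, List.In P l -> forall n, (n0 <= n)%N ->
    (is_assoc_prime (fobj F (Q n)) P <-> is_assoc_prime (fobj F (Q n0)) P).
  elim: l {Hl} => [|P l [k k1 IH]]; first by exists 1%N.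
  have [j j1 Hj] := assoc_prime_eventually_constant idealI fgM linF quoQ P dedR fgF In0.
  exists (maxn j k); first by rewrite leq_max j1.
  move=> P' [<-|P'l] n; rewrite geq_max => /andP[jn kn].
    by rewrite Hj // Hj // leq_maxl.
  by rewrite IH // IH // leq_maxr.
exists n0; split=> // n n0n P; have n1 := leq_trans n01 n0n.
(* Outside the list [P] is associated to neither module, as an associated prime contains [I]. *)
have [Pl|nPl] := EM (List.In P l); first exact: Hn0.
split=> ass; case: nPl; apply: Hl; try (by case: ass).
  exact: (assoc_prime_contains fgM linF quoQ n1 ass).
exact: (assoc_prime_contains fgM linF quoQ n01 ass).
Qed.
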